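(* Let $\Gamma$ be a finite connected multigraph without self-loops and with at least two vertices, with a chosen sink $v_*$, non-sink vertex set $\mathcal{V}'$, degree function $d:\mathcal{V}'\to\mathbb{Z}$ and reduced Laplacian $L'$. Let $\sigma\in\mathbb{Z}^{\mathcal{V}'}$ be uniformly large, i.e. $\sigma\ge d-1$. Then the $\mathbb{R}$-odometer of $\sigma$ is $$u_\sigma^{\mathbb{R}}=(L')^{-1}(\sigma-d+1).$$ Moreover, $\sigma$ is immutable if and only if $(L')^{-1}(\sigma-d+1)\in\mathbb{Z}^{\mathcal{V}'}$.
   Context: $\Gamma$ has vertex set $\mathcal{V}$, and $\mathcal{V}'=\mathcal{V}\setminus\{v_*\}$. For $v\in\mathcal{V}$, $d(v)$ is the degree of $v$ in $\Gamma$ (number of edges at $v$, including edges to the sink). The Laplacian $L$ is the $\mathcal{V}\times\mathcal{V}$ matrix with $L_{vv}=d(v)$ and $L_{vw}=-\#(v,w)$ for $v\ne w$, where $\#(v,w)$ is the number of edges joining $v$ and $w$. The reduced Laplacian $L'$ is the $\mathcal{V}'\times\mathcal{V}'$ matrix obtained from $L$ by deleting the row and column of $v_*$; it is invertible over $\mathbb{R}$. Inequalities between functions on $\mathcal{V}'$ are pointwise, and constants such as $1$ denote constant functions. A sandpile is a non-negative element of $\mathbb{Z}^{\mathcal{V}'}$. Odometers: for $G\in\{\mathbb{Z},\mathbb{R}\}$ and $\sigma\in\mathbb{Z}^{\mathcal{V}'}$, the $G$-odometer $u_\sigma^G\in G^{\mathcal{V}'}$ is the (existing and unique) element satisfying $\sigma-L'u\le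 d-1$ and $u\ge 0$ which is minimal, i.e. $u_\sigma^G\le u$ for every $u\in G^{\mathcal{V}'}$ satisfying both inequalities. The sandpile $\sigma$ is immutable if $u_\sigma^{\mathbb{Z}}=u_\sigma^{\mathbb{R}}$, and mutable otherwise. *)

(* Defs.v *)
From HB Require Import structures.
From mathcomp Require Import all_boot all_order all_algebra.
From mathcomp Require Import reals.

Set Implicit Arguments.
Unset Strict Implicit.
Unset Printing Implicit Defensive.

Import Order.TTheory GRing.Theory Num.Theory.

Local Open Scope ring_scope.

(* Every edge has exactly two distinct endpoints, so there are no self-loops;
   parallel edges are distinct elements of [edge] with equal [ends]. *)
Record multigraph (V : finType) := Multigraph {
  edge : finType;
  ends : edge -> {set V};
  card_ends : forall e : edge, #|ends e| = 2%N
}.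

Section Sandpile.
Variables (V : finType) (Gamma : multigraph V).

Definition num_edges (v w : V) : nat :=
  #|[set e : edge Gamma | ends e == [set v; w]]|.

Definition degree (v : V) : nat := #|[set e : edge Gamma | v \in ends e]|.

Definition connected : Prop :=
  forall v w : V, connect (fun x y : V => (0 < num_edges x y)%N) v w.

(* Matrices indexed by V are indexed by 'I_#|V| through [enum_val]. *)
Definition laplacian : 'M[int]_#|V| :=
  \matrix_(i, j)
    let v := enum_val i in let w := enum_val j in
    if v == w then (degree v)%:Z else - (num_edges v w)%:Z.

Variable sink : V.

(* With V' := V minus the sink, G^V' is 'cV[G]_(#|V|.-1): the entry of index i
   is the value at the vertex [enum_val (lift (enum_rank sink) i)], which is
   the indexing that [row'] and [col'] induce. *)
Definition reduced_laplacian : 'M[int]_(#|V|.-1) :=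
  row' (enum_rank sink) (col' (enum_rank sink) laplacian).

Definition degree_vec : 'cV[int]_(#|V|.-1) :=
  row' (enum_rank sink) (\col_i (degree (enum_val i))%:Z).

Definition pointwise_le (G : numDomainType) (n : nat) (x y : 'cV[G]_n) : Prop :=
  forall i, x i ord0 <= y i ord0.

Definition uniformly_large (sigma : 'cV[int]_(#|V|.-1)) : Prop :=
  pointwise_le (degree_vec - const_mx 1) sigma.

Definition stabilizing (G : numDomainType) (sigma : 'cV[int]_(#|V|.-1))
    (u : 'cV[G]_(#|V|.-1)) : Prop :=
  pointwise_le (map_mx intr sigma - map_mx intr reduced_laplacian *m u)
               (map_mx intr degree_vec - const_mx 1)
  /\ pointwise_le 0 u.

(* "u is the G-odometer of sigma". *)
Definition is_odometer (G : numDomainType) (sigma : 'cV[int]_(#|V|.-1))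
    (u : 'cV[G]_(#|V|.-1)) : Prop :=
  stabilizing sigma u
  /\ forall u' : 'cV[G]_(#|V|.-1), stabilizing sigma u' -> pointwise_le u u'.

Lemma odometer_unique (G : numDomainType) (sigma : 'cV[int]_(#|V|.-1))
    (u1 u2 : 'cV[G]_(#|V|.-1)) :
  is_odometer sigma u1 -> is_odometer sigma u2 -> u1 = u2.
Proof.
move=> [s1 m1] [s2 m2]; apply/matrixP => i j; rewrite ord1.
by apply/eqP; rewrite eq_le (m1 _ s2 i) (m2 _ s1 i).
Qed.

Definition immutable (R : realType) (sigma : 'cV[int]_(#|V|.-1)) : Prop :=
  exists (uZ : 'cV[int]_(#|V|.-1)) (uR : 'cV[R]_(#|V|.-1)),
    [/\ is_odometer sigma uZ, is_odometer sigma uR & map_mx intr uZ = uR].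

End Sandpile.

(* Main.v *)
Require Import Defs.
From HB Require Import structures.
From mathcomp Require Import all_boot all_order all_algebra.
From mathcomp Require Import reals lra.

Set Implicit Arguments.
Unset Strict Implicit.
Unset Printing Implicit Defensive.

Import Order.TTheory GRing.Theory Num.Theory.

Local Open Scope ring_scope.

(** When [sigma >= d - 1], the vector [u = L'^-1 (sigma - d + 1)] makes the
    stabilization constraint [sigma - L' u <= d - 1] an equality.  Everything
    then follows from inverse positivity of the reduced Laplacian: if
    [L' w >= 0] then [w >= 0] ([reduced_laplacian_ge0]).  Applied to [w = u] it
    gives [u >= 0]; applied to [w = u' - u], where [u'] is any other
    stabilizing vector, it gives minimality of [u]; applied to [w] and [- w]
    for [w] in the kernel, it gives invertibility of [L'].

    Inverse positivity is the discrete minimum principle.  Extend [w] by [0] at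
    the sink; at each other vertex [v],
    [(L' w) v = \sum_x #(v, x) (w v - w x)], so [L' w >= 0] says that [w] is
    superharmonic off the sink.  At a minimum other than the sink all the
    summands are nonpositive, so they vanish and the neighbours are minima too; by
    connectedness the sink is one, and the minimum of [w] is [0].

    With [sigma >= d - 1], every solution of [L' u = sigma - d + 1] is an
    odometer, over any totally ordered domain ([is_odometer_of_eq]).  Hence, if the real solution [u] has
    integer entries, it is the [Z]-odometer as well; conversely, immutability
    exhibits the unique [R]-odometer as an integer vector. *)

Section Graph.
Variables (V : finType) (Gamma : multigraph V).

Lemma num_edges_loop (v : V) : num_edges Gamma v v = 0%N.
Proof.
apply/eqP; rewrite cards_eq0; apply/eqP/setP => e; rewrite !inE.
apply/negP => /eqP ends_e.
by have := card_ends e; rewrite ends_e setUid cards1.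
Qed.

(** Handshake at one vertex: an edge at [v] has exactly one other endpoint. *)
Lemma degree_sum (v : V) : degree Gamma v = (\sum_w num_edges Gamma v w)%N.
Proof.
rewrite /degree /num_edges -sum1_card.
under [RHS]eq_bigr do rewrite -sum1_card.
rewrite (exchange_big_dep (mem [set e : edge Gamma | v \in ends e])) /=; last first.
  by move=> w e _; rewrite !inE => /eqP ->; rewrite set21.
apply: eq_bigr => e; rewrite inE => v_e.
have /cards1P[w ends_v] : #|ends e :\ v| == 1%N.
  by have := cardsD1 v (ends e); rewrite card_ends v_e add1n => -[<-].
have /setD1P[w_v _] : w \in ends e :\ v by rewrite ends_v set11.
rewrite (big_pred1 w) // => x; rewrite inE -(setD1K v_e) ends_v.
apply/eqP/eqP => [/setP/(_ w)|-> //].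
by rewrite !inE eqxx (negPf w_v) => /esym/eqP.
Qed.

(** Superharmonicity at a minimum forces all its neighbours to be minima, so
    the minima spread along paths until they reach [s]. *)
Lemma minimum_principle (R : realDomainType) (s : V) (f : V -> R) :
  connected Gamma ->
  (forall v, v != s -> 0 <= \sum_w (num_edges Gamma v w)%:R * (f v - f w)) ->
  forall v, f s <= f v.
Proof.
move=> conn superh.
case: (arg_minP f (erefl : xpredT s)) => m _ min_m v.
suff /eqP-> : f s == f m by exact: min_m.
(* Walk from a minimum to [s], staying among the minima. *)
have [p] := connectP (conn m s).
have : f m == f m by [].
elim: p {1 3 4}m => [|y p IHp] x /= fx; first by move=> _ ->.
case/andP=> xy p_path s_last; have [xs|xs] := eqVneq x s; first by rewrite -xs.
apply: (IHp y _ p_path s_last).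
have terms_ge0 w : true -> 0 <= (num_edges Gamma x w)%:R * (f w - f x).
  by move=> _; rewrite mulr_ge0 ?ler0n // subr_ge0 (eqP fx) min_m.
have /eqP : \sum_w (num_edges Gamma x w)%:R * (f w - f x) = 0.
  apply/eqP; rewrite eq_le sumr_ge0 // andbT -oppr_ge0 -sumrN.
  by under eq_bigr do rewrite -mulrN opprB; exact: superh.
rewrite psumr_eq0 // => /allP/(_ y); rewrite mem_index_enum => /(_ isT)/=.
by rewrite mulf_eq0 pnatr_eq0 -leqn0 leqNgt xy subr_eq0 (eqP fx).
Qed.

Variable s : V.

Definition nonsink (i : 'I_#|V|.-1) : V := enum_val (lift (enum_rank s) i).

Definition extend0 (R : pzRingType) (w : 'cV[R]_#|V|.-1) (v : V) : R :=
  if unlift (enum_rank s) (enum_rank v) is Some i then w i ord0 else 0.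

Lemma extend0_nonsink (R : pzRingType) (w : 'cV[R]_#|V|.-1) i :
  extend0 w (nonsink i) = w i ord0.
Proof. by rewrite /extend0 /nonsink enum_valK liftK. Qed.

Lemma extend0_sink (R : pzRingType) (w : 'cV[R]_#|V|.-1) : extend0 w s = 0.
Proof. by rewrite /extend0 unlift_none. Qed.

Lemma nonsinkP (v : V) : v != s -> exists i, v = nonsink i.
Proof.
move=> v_s; have rank_v : enum_rank s != enum_rank v.
  by rewrite (inj_eq enum_rank_inj) eq_sym.
have [i def_v _] := unlift_some rank_v.
by exists i; rewrite /nonsink -def_v enum_rankK.
Qed.

Lemma reduced_laplacianE i j :
  reduced_laplacian Gamma s i j =
    (degree Gamma (nonsink i))%:Z *+ (i == j)
    - (num_edges Gamma (nonsink i) (nonsink j))%:Z.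
Proof.
rewrite !mxE /= -/(nonsink i) -/(nonsink j).
rewrite (inj_eq enum_val_inj) (inj_eq (@lift_inj _ _)).
by have [->|_] := eqVneq i j; rewrite ?num_edges_loop ?subr0 ?sub0r.
Qed.

(** Values at the sink contribute nothing, so [L'] acts on [w] as the full
    Laplacian acts on the extension of [w] by zero. *)
Lemma reduced_laplacian_mulE (R : pzRingType) (w : 'cV[R]_#|V|.-1) i :
  (map_mx intr (reduced_laplacian Gamma s) *m w) i ord0 =
  \sum_x (num_edges Gamma (nonsink i) x)%:R
           * (extend0 w (nonsink i) - extend0 w x).
Proof.
under eq_bigr do rewrite mulrBr.
rewrite sumrB -mulr_suml -natr_sum -degree_sum extend0_nonsink.
rewrite (big_enum_val (A := predT)) (bigD1_ord (enum_rank s)) //=.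
rewrite enum_rankK extend0_sink mulr0 add0r mxE.
under [LHS]eq_bigr => j _.
  rewrite [_ i j]mxE reduced_laplacianE rmorphB rmorphMn /= mulrBl.
  over.
rewrite sumrB; congr (_ - _).
  rewrite (bigD1 i) //= eqxx big1 ?addr0 // => j /negPf.
  by rewrite eq_sym => ->; rewrite mul0r.
by apply: eq_bigr => j _; rewrite -/(nonsink j) extend0_nonsink.
Qed.

(** Inverse positivity: the minimum principle for the extension by zero. *)
Lemma reduced_laplacian_ge0 (R : realDomainType) (w : 'cV[R]_#|V|.-1) :
  connected Gamma ->
  pointwise_le 0 (map_mx intr (reduced_laplacian Gamma s) *m w) ->
  pointwise_le 0 w.
Proof.
move=> conn Lw_ge0 i; rewrite mxE -extend0_nonsink -(extend0_sink w).
apply: minimum_principle => // v /nonsinkP[j ->].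
by rewrite -reduced_laplacian_mulE; have := Lw_ge0 j; rewrite mxE.
Qed.

Lemma reduced_laplacian_unit (R : realFieldType) :
  connected Gamma ->
  map_mx intr (reduced_laplacian Gamma s) \in @unitmx R _.
Proof.
move=> conn; rewrite unitmxE unitfE -det_tr.
apply/det0P => -[v v_neq0 /(congr1 trmx)].
rewrite trmx_mul trmxK trmx0 => Lv0; case/eqP: v_neq0.
apply/matrixP => i j; rewrite ord1 !mxE; apply/eqP; rewrite eq_le.
have := @reduced_laplacian_ge0 R v^T conn; rewrite Lv0 => /(_ (fun=> lexx _) j).
have := @reduced_laplacian_ge0 R (- v^T) conn.
rewrite mulmxN Lv0 oppr0 => /(_ (fun=> lexx _) j).
by rewrite !mxE oppr_ge0 => -> ->.
Qed.

(** The constraint holds with equality, and any other stabilizing vector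
    differs from this one by a vector whose image under [L'] is nonnegative. *)
Lemma is_odometer_of_eq (R : realDomainType) (sigma : 'cV[int]_#|V|.-1)
    (u : 'cV[R]_#|V|.-1) :
  connected Gamma -> uniformly_large Gamma s sigma ->
  map_mx intr (reduced_laplacian Gamma s) *m u
    = map_mx intr (sigma - degree_vec Gamma s + const_mx 1) ->
  is_odometer Gamma s sigma u.
Proof.
move=> conn large Lu; split; first split.
- by move=> i; rewrite Lu !mxE rmorphD rmorphB /= opprD opprB addrA subrKC.
- apply: reduced_laplacian_ge0 => // i; rewrite Lu !mxE ler0z.
  by have := large i; rewrite !mxE -subr_ge0 opprB addrA addrAC.
move=> u' [stab _] i; rewrite -subr_ge0.
have := @reduced_laplacian_ge0 R (u' - u) conn; rewrite mulmxBr Lu.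
move=> /(_ _ i); rewrite !mxE; apply => j.
have := stab j; rewrite !mxE rmorphD rmorphB /=; lra.
Qed.

End Graph.

Theorem theorem1p1 (R : realType) (V : finType) (Gamma : multigraph V)
    (sink : V) (hconn : connected Gamma) (hV : (1 < #|V|)%N)
    (sigma : 'cV[int]_(#|V|.-1)) (hsigma : uniformly_large Gamma sink sigma) :
  let u : 'cV[R]_(#|V|.-1) :=
    invmx (map_mx intr (reduced_laplacian Gamma sink))
      *m map_mx intr (sigma - degree_vec Gamma sink + const_mx 1) in
  is_odometer Gamma sink sigma u
  /\ (immutable Gamma sink R sigma <-> u \is a mxOver Num.int).
Proof.
move=> u; pose L := reduced_laplacian Gamma sink.
have Lu : map_mx intr L *m u
    = map_mx intr (sigma - degree_vec Gamma sink + const_mx 1).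
  by rewrite mulKVmx // reduced_laplacian_unit.
have odo_u : is_odometer Gamma sink sigma u by exact: is_odometer_of_eq.
split=> //; split.
  move=> [uZ [uR [_ odo_uR uZR]]]; rewrite (odometer_unique odo_u odo_uR) -uZR.
  by apply/mxOverP => i j; rewrite mxE intr_int.
move=> /mxOverP u_int; pose uZ := map_mx Num.floor u.
have uZE : map_mx intr uZ = u.
  by apply/matrixP => i j; rewrite mxE [uZ i j]mxE floorK.
exists uZ, u; split=> //; apply: is_odometer_of_eq => //.
have map_intz m n (A : 'M[int]_(m, n)) : map_mx intr A = A.
  by apply/matrixP => i j; rewrite mxE intz.
rewrite map_intz [RHS]map_intz; move: Lu; rewrite -uZE -map_mxM => /matrixP Lu.
by apply/matrixP => i j; have := Lu i j; rewrite [LHS]mxE [RHS]mxE => /intr_inj.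
Qed.
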